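(* Let $T$ be a lobster, let $v$ be a vertex of its spine, and suppose that two pendant paths of length $2$, namely $v\,u_1\,u_2$ and $v\,u_3\,u_4$, are attached to $v$; that is, $u_1,u_2,u_3,u_4$ are distinct vertices of $T$, the neighbours of $u_1$ are exactly $v$ and $u_2$, the only neighbour of $u_2$ is $u_1$, the neighbours of $u_3$ are exactly $v$ and $u_4$, and the only neighbour of $u_4$ is $u_3$. Then $S=\{u_1,u_2,u_3,u_4\}$ is a minimum perfect critical set of $T$.
   Context: Graphs are finite, undirected, unweighted and simple. A spine of a tree $T$ is a longest path in $T$. A tree is a lobster (a $2$-distant tree) if it has a spine $P$ such that every vertex of $T$ is at distance at most $2$ from some vertex of $P$. For a graph $G=(V,E)$, the Laplacian is $L=\Delta(G)-D(G)$, where $\Delta(G)$ is the diagonal matrix of vertex degrees and $D(G)$ is the $0$-$1$ adjacency matrix. For $S\subset V$ put $\overline{S}=V\setminus S$. For a vector $y$ indexed by $V$, $y_S$ denotes the vector obtained from $y$ by deleting the entries indexed by $\overline{S}$; eigenvectors are nonzero. A nonempty $S\subseteq V$ is a critical set if there is an eigenvector $y$ of $L$ with $y_{\overline{S}}=0$. A critical set $S$ is a perfect critical set if there is an eigenvector $y$ of $L$ with $y_{\overline{S}}=0$ and $y_v\neq 0$ for every $v\in S$. A perfect critical set is a minimum perfect critical set if no proper subset of it is a perfect critical set. *)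

(* Defs.v *)
From HB Require Import structures.
From mathcomp Require Import all_boot all_order all_algebra.
Set Implicit Arguments.
Unset Strict Implicit.
Unset Printing Implicit Defensive.
Import GRing.Theory Num.Theory.
Local Open Scope ring_scope.

(* A graph on the finite vertex type V is given by its adjacency relation. *)
Section Graphs.
Variables (V : finType) (e : rel V).

Definition simple_graph : Prop := symmetric e /\ irreflexive e.

Definition neighbours (x : V) : {set V} := [set y | e x y].

Definition degree (x : V) : nat := #|neighbours x|.

Definition connected_graph : Prop :=
  (0 < #|V|)%N /\ forall x y : V, connect e x y.

(* Closed walks of length 2 back and forth along an edge are "ucycle"s of
   size 2, so genuine cycles are those with at least three vertices. *)
Definition acyclic_graph : Prop :=
  forall c : seq V, ucycle e c -> (size c < 3)%N.

Definition tree : Prop :=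
  [/\ simple_graph, connected_graph & acyclic_graph].

Definition is_path (p : seq V) : bool := [&& p != [::], sorted e p & uniq p].

Definition spine (p : seq V) : Prop :=
  is_path p /\ forall q : seq V, is_path q -> (size q <= size p)%N.

(* Least length of a walk from x to y; the junk value is #|V| when y cannot be
   reached from x (in a connected graph all distances are smaller than #|V|). *)
Definition dist (x y : V) : nat :=
  find (fun k => [exists w : k.-tuple V, path e x w && (last x w == y)])
       (iota 0 #|V|).

Definition lobster : Prop :=
  tree /\
  exists2 p : seq V, spine p &
    forall x : V, exists2 y : V, y \in p & (dist x y <= 2)%N.

End Graphs.

(* Matrices and vectors indexed by V are indexed by 'I_#|V|, through the
   bijection enum_val / enum_rank between 'I_#|V| and V. *)
Section CriticalSets.
Variables (R : rcfType) (V : finType) (e : rel V).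

Definition degree_mx : 'M[R]_#|V| :=
  diag_mx (\row_i (degree e (enum_val i))%:R).

Definition adjacency_mx : 'M[R]_#|V| :=
  \matrix_(i, j) (e (enum_val i) (enum_val j))%:R.

Definition laplacian : 'M[R]_#|V| := degree_mx - adjacency_mx.

Definition eigenvector n (A : 'M[R]_n) (y : 'cV[R]_n) : Prop :=
  y != 0 /\ exists a : R, A *m y = a *: y.

Definition entry (y : 'cV[R]_#|V|) (v : V) : R := y (enum_rank v) 0.

(* The vector y_S, obtained from y by deleting the entries outside S. *)
Definition subvector (y : 'cV[R]_#|V|) (S : {set V}) : 'cV[R]_#|S| :=
  \col_(i < #|S|) entry y (enum_val i).

Definition critical_set (S : {set V}) : Prop :=
  S != set0 /\
  exists2 y : 'cV[R]_#|V|, eigenvector laplacian y & subvector y (~: S) = 0.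

Definition perfect_critical_set (S : {set V}) : Prop :=
  critical_set S /\
  exists y : 'cV[R]_#|V|,
    [/\ eigenvector laplacian y, subvector y (~: S) = 0
      & forall v : V, v \in S -> entry y v != 0].

Definition minimum_perfect_critical_set (S : {set V}) : Prop :=
  perfect_critical_set S /\
  forall S' : {set V}, S' \proper S -> ~ perfect_critical_set S'.

End CriticalSets.

(* Main.v *)
(** A vector supported on [{u1, u2, u3, u4}] is mapped by the Laplacian to
    [2 y1 - y2], [y2 - y1], [2 y3 - y4], [y4 - y3] at the [u_i], to
    [- (y1 + y3)] at [v], and to [0] elsewhere. So the antisymmetric vector
    [(1, b, -1, -b)] is an eigenvector as soon as [2 - b = a] and
    [b - 1 = a b], i.e. [b ^ 2 = b + 1]: take for [b] the golden ratio.
    Conversely, for an eigenvector so supported, the rows [u1], [u2], [u3],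
    [u4] and [v] show that if one of the four entries vanishes, all do. *)
Require Import Defs.
From HB Require Import structures.
From mathcomp Require Import all_boot all_order all_algebra.
From mathcomp Require Import ring lra.
Set Implicit Arguments.
Unset Strict Implicit.
Unset Printing Implicit Defensive.
Import Order.TTheory GRing.Theory Num.Theory.
Local Open Scope ring_scope.

Section LaplacianEntries.
Variables (R : rcfType) (V : finType) (e : rel V).
Implicit Types (x : V) (y : 'cV[R]_#|V|) (S : {set V}).

Lemma entry_laplacian y x :
  entry (laplacian R e *m y) x =
  (degree e x)%:R * entry y x - \sum_z (e x z)%:R * entry y z.
Proof.
rewrite /entry /laplacian /degree_mx mulmxBl mul_diag_mx !mxE enum_rankK.
congr (_ - _).
(* The matrix product sums over ordinals; [enum_rank] carries that sum over to vertices. *)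
rewrite (reindex enum_rank) /=; last exact/onW_bij/enum_rank_bij.
by apply: eq_bigr => z _; rewrite !mxE !enum_rankK.
Qed.

(** Entries off [s] contribute nothing. Listing the support makes the sum unfold into explicit
    terms. *)
Lemma entry_laplacian_supp (s : seq V) y x : uniq s ->
    (forall z, z \notin s -> entry y z = 0) ->
  entry (laplacian R e *m y) x =
  (degree e x)%:R * entry y x - \sum_(z <- s) (e x z)%:R * entry y z.
Proof.
move=> s_uniq y0; rewrite entry_laplacian (big_uniq _ s_uniq) /=; congr (_ - _).
rewrite [RHS]big_mkcond; apply: eq_bigr => z _.
by case: ifPn => // /y0->; rewrite mulr0.
Qed.

Lemma entry_inj y y' : (forall x, entry y x = entry y' x) -> y = y'.
Proof.
move=> yy'; apply/matrixP=> i j; rewrite ord1.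
by have := yy' (enum_val i); rewrite /entry enum_valK.
Qed.

Lemma subvector_eq0 S y :
  subvector y S = 0 <-> forall x, x \in S -> entry y x = 0.
Proof.
split=> [yS0 x xS | yS0].
  have /matrixP/(_ (enum_rank_in xS x) 0) := yS0.
  by rewrite !mxE enum_rankK_in.
by apply/matrixP=> i j; rewrite !mxE yS0 // enum_valP.
Qed.

End LaplacianEntries.

Lemma golden_ratio_exists (R : rcfType) : exists2 b : R, b != 0 & b ^+ 2 = b + 1.
Proof.
have s5 : Num.sqrt 5 ^+ 2 = 5 :> R by rewrite sqr_sqrtr.
have s0 : 0 <= Num.sqrt 5 :> R by exact: sqrtr_ge0.
by exists ((1 + Num.sqrt 5) / 2); [rewrite gt_eqF; lra | field: s5].
Qed.

Section TwoPendantPaths.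
Variables (R : rcfType) (V : finType) (e : rel V) (v u1 u2 u3 u4 : V).
Hypotheses (e_simple : simple_graph e) (u_uniq : uniq [:: u1; u2; u3; u4]).
Hypotheses (Nu1 : neighbours e u1 = [set v; u2]) (Nu2 : neighbours e u2 = [set u1]).
Hypotheses (Nu3 : neighbours e u3 = [set v; u4]) (Nu4 : neighbours e u4 = [set u3]).

Let S := [set u1; u2; u3; u4].

Let in_S x : (x \in S) = (x \in [:: u1; u2; u3; u4]).
Proof. by rewrite !inE !orbA. Qed.

(** Symmetry turns adjacency to some [u_i] into membership in its known neighbourhood. *)
Let edge x z : e x z = (x \in neighbours e z).
Proof. by rewrite inE (proj1 e_simple). Qed.

(** If [v] were [u1] or [u3] there would be a loop; if [v] were [u2], then [u3] would be a neighbour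
    of [u2]; if [v] were [u4], then [u1] would be a neighbour of [u4]. *)
Lemma attachment_notin : v \notin [:: u1; u2; u3; u4].
Proof.
have [_ e_irr] := e_simple.
have ev1 : e v u1 by rewrite edge Nu1 !inE eqxx.
have ev3 : e v u3 by rewrite edge Nu3 !inE eqxx.
move: u_uniq; rewrite /= !inE !negb_or.
case/and4P=> /and3P[n12 n13 n14] /andP[n23 n24] n34 _.
apply/and4P; split; apply/eqP=> vu; rewrite vu in ev1 ev3.
- by rewrite e_irr in ev1.
- by move: ev3; rewrite -[e _ _]in_set -/(neighbours e u2) Nu2 inE eq_sym (negPf n13).
- by rewrite e_irr in ev3.
- by move: ev1; rewrite -[e _ _]in_set -/(neighbours e u4) Nu4 inE (negPf n13).
Qed.

Lemma entry_laplacian_paths (y : 'cV[R]_#|V|) x :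
    (forall z, z \notin S -> entry y z = 0) ->
  entry (laplacian R e *m y) x =
    if x == u1 then 2 * entry y u1 - entry y u2
    else if x == u2 then entry y u2 - entry y u1
    else if x == u3 then 2 * entry y u3 - entry y u4
    else if x == u4 then entry y u4 - entry y u3
    else if x == v then - (entry y u1 + entry y u3)
    else 0.
Proof.
move=> yS0.
have := attachment_notin; rewrite !inE !negb_or => /and4P[nv1 nv2 nv3 nv4].
move: (u_uniq); rewrite /= !inE !negb_or.
case/and4P=> /and3P[n12 n13 n14] /andP[n23 n24] n34 _.
rewrite (entry_laplacian_supp _ _ u_uniq) => [|z]; last by rewrite -in_S => /yS0.
rewrite !big_cons big_nil !edge Nu1 Nu2 Nu3 Nu4 !inE /degree.
have [->|x1] := eqVneq x u1.
  by rewrite Nu1 cards2 nv2 (eq_sym u1 v) (negPf nv1)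
    (negPf n12) (negPf n13) (negPf n14) /=; ring.
have [->|x2] := eqVneq x u2.
  by rewrite Nu2 cards1 (eq_sym u2 v) (negPf nv2) (negPf n23) (negPf n24) /=; ring.
have [->|x3] := eqVneq x u3.
  by rewrite Nu3 cards2 nv4 (eq_sym u3 v) (negPf nv3) (negPf n34) /=; ring.
have [->|x4] := eqVneq x u4.
  by rewrite Nu4 cards1 (eq_sym u4 v) (negPf nv4) /=; ring.
(* Outside [S] the degree is multiplied by a zero entry, so only the adjacency terms remain, and
   these are nonzero only for [u1] and [u3] at [x = v]. *)
have yx : entry y x = 0 by apply: yS0; rewrite in_S !inE !negb_or x1 x2 x3 x4.
by have [_|_] := eqVneq x v; rewrite yx /=; ring.
Qed.

Lemma perfect_critical_paths : perfect_critical_set R e S.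
Proof.
have [b b0 b2] := golden_ratio_exists R.
move: (u_uniq); rewrite /= !inE !negb_or.
case/and4P=> /and3P[n12 n13 n14] /andP[n23 n24] n34 _.
pose f x : R := if x == u1 then 1 else if x == u2 then b
  else if x == u3 then -1 else if x == u4 then - b else 0.
pose y : 'cV[R]_#|V| := \col_i f (enum_val i).
have yE x : entry y x = f x by rewrite /entry mxE enum_rankK.
have f1 : f u1 = 1 by rewrite /f eqxx.
have f2 : f u2 = b by rewrite /f eqxx eq_sym (negPf n12).
have f3 : f u3 = -1 by rewrite /f eqxx !(eq_sym u3) (negPf n13) (negPf n23).
have f4 : f u4 = - b.
  by rewrite /f eqxx !(eq_sym u4) (negPf n14) (negPf n24) (negPf n34).
have yS0 z : z \notin S -> entry y z = 0.
  rewrite yE in_S !inE !negb_or /f.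
  by case/and4P=> /negPf-> /negPf-> /negPf-> /negPf->.
have y_eig : eigenvector (laplacian R e) y.
  split.
    apply/eqP=> y0; have := yE u1.
    by rewrite f1 y0 /entry mxE => /esym/eqP; rewrite oner_eq0.
  (* The eigenvalue is forced by row [u1], where the entry is 1. Row [u2] then reads
     [b - 1 = (2 - b) * b], which is [b2]. *)
  exists (2 - b); apply: entry_inj => x.
  rewrite entry_laplacian_paths // !yE f1 f2 f3 f4.
  have -> : entry ((2 - b) *: y) x = (2 - b) * f x by rewrite -yE /entry mxE.
  rewrite /f; do 4![case: ifP => _; first ring: b2].
  (* At [v] the contributions 1 and -1 of [u1] and [u3] cancel. *)
  by case: ifP => _; ring.
have y_supp : subvector y (~: S) = 0.
  by apply/subvector_eq0 => x; rewrite inE => /yS0.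
split; first by split; [apply/set0Pn; exists u1; rewrite in_S !inE eqxx | exists y].
exists y; split=> // x; rewrite yE in_S !inE.
by case/or4P=> /eqP->; rewrite ?f1 ?f2 ?f3 ?f4 ?oppr_eq0 ?oner_eq0.
Qed.

(** A proper subset of [S] misses some [u_i], so its eigenvector vanishes there; the rows spread
    this zero to all of [S], contradicting [y != 0]. *)
Lemma minimum_perfect_critical_paths : minimum_perfect_critical_set R e S.
Proof.
split=> [|S' /properP[S'S [x xS xS']]]; first exact: perfect_critical_paths.
case=> _ [y [[y_neq0 [a Ly]] /subvector_eq0 yS'0 _]].
have y0 z : z \notin S' -> entry y z = 0 by move=> zS'; rewrite yS'0 ?inE.
have yS0 z : z \notin S -> entry y z = 0.
  by move=> zS; apply: y0; apply: contra zS; apply: subsetP.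
have row z : entry (laplacian R e *m y) z = a * entry y z.
  by rewrite Ly /entry mxE.
have := attachment_notin; rewrite !inE !negb_or => /and4P[nv1 nv2 nv3 nv4].
move: (u_uniq); rewrite /= !inE !negb_or.
case/and4P=> /and3P[n12 n13 n14] /andP[n23 n24] n34 _.
have yv : entry y v = 0 by apply: yS0; rewrite in_S attachment_notin.
have r1 := row u1; have r2 := row u2; have r3 := row u3; have r4 := row u4.
have rv := row v; rewrite !entry_laplacian_paths // in r1 r2 r3 r4 rv.
rewrite eqxx in r1; rewrite eqxx eq_sym (negPf n12) in r2.
rewrite eqxx !(eq_sym u3) (negPf n13) (negPf n23) in r3.
rewrite eqxx !(eq_sym u4) (negPf n14) (negPf n24) (negPf n34) in r4.
rewrite eqxx yv (negPf nv1) (negPf nv2) (negPf nv3) (negPf nv4) mulr0 in rv.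
(* Row [v] says [y1 + y3 = 0], so either zero gives the other. A zero at [u2] or [u4] passes to [u1]
   or [u3] by row [u2] or [u4]. Substituting the zero removes the products with [a] that matter,
   leaving linear arithmetic. *)
have [y1 y3] : entry y u1 = 0 /\ entry y u3 = 0.
  have yx := y0 x xS'; move: xS; rewrite in_S !inE.
  by case/or4P=> /eqP xu; rewrite xu in yx;
    rewrite yx ?mulr0 in r1 r2 r3 r4 rv; lra.
have y2 : entry y u2 = 0 by rewrite y1 mulr0 in r1; lra.
have y4 : entry y u4 = 0 by rewrite y3 mulr0 in r3; lra.
case/eqP: y_neq0; apply: entry_inj => z; rewrite [RHS]mxE.
have [|/yS0 //] := boolP (z \in S).
by rewrite in_S !inE => /or4P[] /eqP->.
Qed.

End TwoPendantPaths.

Theorem theorem4 (R : rcfType) (V : finType) (e : rel V) (p : seq V)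
    (v u1 u2 u3 u4 : V) :
  lobster e ->
  spine e p ->
  v \in p ->
  uniq [:: u1; u2; u3; u4] ->
  neighbours e u1 = [set v; u2] ->
  neighbours e u2 = [set u1] ->
  neighbours e u3 = [set v; u4] ->
  neighbours e u4 = [set u3] ->
  minimum_perfect_critical_set R e [set u1; u2; u3; u4].
Proof.
by move=> [[e_simple _ _] _] _ _; apply: minimum_perfect_critical_paths.
Qed.
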